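(* Let $\Omega$ be a commutative semigroup, let $(A,( *_{\alpha,\beta})_{\alpha,\beta\in\Omega})$ be a commutative $\Omega$-associative $H$-pseudoalgebra, and let $\mathfrak{T}^{t}_{\alpha,\beta}=\sum_{i=0}^{\infty}T^{(i)}_{\alpha,\beta}t^{i}$ ($\alpha,\beta\in\Omega$) be a formal deformation of $A$. Define $$\{x*_{\alpha,\beta}y\}=T^{(1)}_{\alpha,\beta}(x,y)-(\sigma\otimes_H \mathrm{id})\,T^{(1)}_{\beta,\alpha}(y,x),\qquad x,y\in A,\ \alpha,\beta\in\Omega .$$ Then $(A,(\{\cdot *_{\alpha,\beta}\cdot\})_{\alpha,\beta\in\Omega},( *_{\alpha,\beta})_{\alpha,\beta\in\Omega})$ is an $\Omega$-Poisson $H$-pseudoalgebra.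
   Context: $k$ is an algebraically closed field of characteristic zero and $H$ is a cocommutative Hopf algebra over $k$ with comultiplication $\Delta$; $\otimes=\otimes_k$. For $n\ge 1$, $H^{\otimes n}$ is a right $H$-module via the iterated comultiplication, and for a left $H$-module $M$ the space $H^{\otimes n}\otimes_H M$ is a left $H^{\otimes n}$-module by left multiplication. A linear map $\mu: L\otimes M\to H^{\otimes 2}\otimes_H N$ (with $L,M,N$ left $H$-modules) is $H^{\otimes 2}$-linear if $\mu(fa,gb)=((f\otimes g)\otimes_H 1)\mu(a,b)$ for all $f,g\in H$. Such maps are composed as follows: if $\mu(x,y)=\sum_i (f_i\otimes g_i)\otimes_H e_i$ and $F\in H^{\otimes 2}$, then $$\mu(F\otimes_H x,\,y)=\sum_i (F\otimes 1)(\Delta\otimes \mathrm{id})(f_i\otimes g_i)\otimes_H e_i,\qquad \mu(x,\,F\otimes_H y)=\sum_i (1\otimes F)(\mathrm{id}\otimes\Delta)(f_i\otimes g_i)\otimes_H e_i,$$ elements of $H^{\otimes 3}\otimes_H N$. $\sigma(f\otimes g)=g\otimes f$ is the flip, $(12)(f\otimes g\otimes h)=g\otimes f\otimes h$, and these act on $H^{\otimes 2}\otimes_H N$, $H^{\otimes 3}\otimes_H N$ as $\sigma\otimes_H\mathrm{id}$, $(12)\otimes_H\mathrm{id}$ (well defined since $H$ is cocommutative). An $\Omega$-associative $H$-pseudoalgebra is a left $H$-module $A$ with $H^{\otimes 2}$-linear maps $*_{\alpha,\beta}:A\otimes A\to H^{\otimes 2}\otimes_H A$ ($\alpha,\beta\in\Omega$)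 such that $(a*_{\alpha,\beta}b)*_{\alpha\beta,\gamma}c=a*_{\alpha,\beta\gamma}(b*_{\beta,\gamma}c)$ for all $a,b,c\in A$, $\alpha,\beta,\gamma\in\Omega$. It is commutative if $x*_{\alpha,\beta}y=(\sigma\otimes_H\mathrm{id})(y*_{\beta,\alpha}x)$ for all $x,y,\alpha,\beta$. A formal deformation of $A$ is a formal sum $\mathfrak{T}^{t}_{\alpha,\beta}=\sum_{i\ge 0}T^{(i)}_{\alpha,\beta}t^i$ where each $T^{(i)}_{\alpha,\beta}:A\otimes A\to H^{\otimes 2}\otimes_H A$ is $H^{\otimes 2}$-linear, $T^{(0)}_{\alpha,\beta}(x,y)=x*_{\alpha,\beta}y$, and $\mathfrak{T}^{t}_{\alpha,\beta\gamma}(x,\mathfrak{T}^{t}_{\beta,\gamma}(y,z))=\mathfrak{T}^{t}_{\alpha\beta,\gamma}(\mathfrak{T}^{t}_{\alpha,\beta}(x,y),z)$ for all $x,y,z\in A$, $\alpha,\beta,\gamma\in\Omega$, i.e. for all $s\ge 0$ $$\sum_{i=0}^{s}T^{(i)}_{\alpha,\beta\gamma}(x,T^{(s-i)}_{\beta,\gamma}(y,z))=\sum_{i=0}^{s}T^{(i)}_{\alpha\beta,\gamma}(T^{(s-i)}_{\alpha,\beta}(x,y),z).$$ An $\Omega$-Lie $H$-pseudoalgebra is a left $H$-module $L$ with $H^{\otimes 2}$-linear maps $[\cdot*_{\alpha,\beta}\cdot]:L\otimes L\to H^{\otimes 2}\otimes_H L$ such that $[x*_{\alpha,\beta}y]=-(\sigma\otimes_H\mathrm{id})[y*_{\beta,\alpha}x]$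 and $[[x*_{\alpha,\beta}y]*_{\alpha\beta,\gamma}z]=[x*_{\alpha,\beta\gamma}[y*_{\beta,\gamma}z]]-((12)\otimes_H\mathrm{id})[y*_{\beta,\alpha\gamma}[x*_{\alpha,\gamma}z]]$ for all $x,y,z\in L$, $\alpha,\beta,\gamma\in\Omega$. An $\Omega$-Poisson $H$-pseudoalgebra is a triple $(P,([\cdot*_{\alpha,\beta}\cdot])_{\alpha,\beta\in\Omega},( *_{\alpha,\beta})_{\alpha,\beta\in\Omega})$ such that $(P,([\cdot*_{\alpha,\beta}\cdot]))$ is an $\Omega$-Lie $H$-pseudoalgebra, $(P,( *_{\alpha,\beta}))$ is a commutative $\Omega$-associative $H$-pseudoalgebra, and $$[x*_{\alpha,\beta\gamma}(y*_{\beta,\gamma}z)]=[x*_{\alpha,\beta}y]*_{\alpha\beta,\gamma}z+((12)\otimes_H\mathrm{id})\,y*_{\beta,\alpha\gamma}[x*_{\alpha,\gamma}z]$$ for all $x,y,z\in P$, $\alpha,\beta,\gamma\in\Omega$. *)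

(* Defs.v *)
From HB Require Import structures.
From mathcomp Require Import all_boot all_algebra.
From mathcomp Require Import boolp classical_sets.
From mathcomp Require Import freeg.

Set Implicit Arguments.
Unset Strict Implicit.
Unset Printing Implicit Defensive.

Import GRing.Theory.

Local Open Scope ring_scope.
Local Open Scope quotient_scope.

Reserved Notation "x \ox y" (at level 40, left associativity).

(** The right R-module N and the left R-module M are given as abelian groups
    with action maps [ract] and [lact]; [btensor ract lact] is N \ox_R M, the
    free abelian group on N * M modulo the subgroup [btensor_rel]. *)

Section BalancedTensor.
Variables (R : Type) (N M : zmodType) (ract : N -> R -> N) (lact : R -> M -> M).

Definition bgen (n : N) (m : M) : {freeg (N * M)%type / int} := << (n, m) >>.

Inductive btensor_rel : {freeg (N * M)%type / int} -> Prop :=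
| btensor_rel0 : btensor_rel 0
| btensor_relB x y : btensor_rel x -> btensor_rel y -> btensor_rel (x - y)
| btensor_relDl n1 n2 m :
    btensor_rel (bgen (n1 + n2) m - bgen n1 m - bgen n2 m)
| btensor_relDr n m1 m2 :
    btensor_rel (bgen n (m1 + m2) - bgen n m1 - bgen n m2)
| btensor_relA n r m :
    btensor_rel (bgen (ract n r) m - bgen n (lact r m)).

Definition btensor_relb : pred {freeg (N * M)%type / int} :=
  fun x => `[< btensor_rel x >].

Fact btensor_rel_closed : zmod_closed btensor_relb.
Proof.
split; first by apply/asboolP; exact: btensor_rel0.
move=> x y /asboolP hx /asboolP hy; apply/asboolP; exact: btensor_relB.
Qed.

HB.instance Definition _ :=
  GRing.isZmodClosed.Build _ btensor_relb btensor_rel_closed.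

Definition btensor : Type := 
  Quotient.quot (GRing.ZmodClosed.clone _ btensor_relb _).

HB.instance Definition _ := GRing.Zmodule.on btensor.

Definition bpure (n : N) (m : M) : btensor := \pi_btensor (bgen n m).

Lemma bpi_eq (x y : {freeg (N * M)%type / int}) : btensor_rel (x - y) ->
  \pi_btensor x = \pi_btensor y :> btensor.
Proof. by move=> h; apply/eqmodP; rewrite /= /Quotient.equiv; apply/asboolP. Qed.

Lemma bpureDl n1 n2 m : bpure (n1 + n2) m = bpure n1 m + bpure n2 m.
Proof.
rewrite /bpure -[RHS]raddfD; apply: bpi_eq.
by rewrite opprD addrA; exact: btensor_relDl.
Qed.

Lemma bpureDr n m1 m2 : bpure n (m1 + m2) = bpure n m1 + bpure n m2.
Proof.
rewrite /bpure -[RHS]raddfD; apply: bpi_eq.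
by rewrite opprD addrA; exact: btensor_relDr.
Qed.

Lemma bpureA n r m : bpure (ract n r) m = bpure n (lact r m).
Proof. by apply: bpi_eq; exact: btensor_relA. Qed.

Lemma bpure0l m : bpure 0 m = 0.
Proof. by apply: (addrI (bpure 0 m)); rewrite -bpureDl !addr0. Qed.

Lemma bpureNl n m : bpure (- n) m = - bpure n m.
Proof. by apply: (addrI (bpure n m)); rewrite -bpureDl !subrr bpure0l. Qed.

Lemma btensor_ind (P : btensor -> Prop) : P 0 ->
  (forall u v, P u -> P v -> P (u + v)) -> (forall n m, P (bpure n m)) ->
  forall u, P u.
Proof.
move=> P0 PD Pp u; rewrite -[u]reprK -[repr u]freeg_sumE raddf_sum /=.
elim/big_ind: _ => [//|x y|[n m] _]; first exact: PD.
have PM v j : P v -> P (v *+ j).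
  by move=> Pv; elim: j => [|j IH]; rewrite ?mulr0n // mulrS; exact: PD.
have E (c : int) : << c *g (n, m) >> = bgen n m *~ c :> {freeg (N * M)%type / int}.
  by rewrite /bgen freeg_mulz intz.
rewrite E raddfMz; case: (coeff _ _) => j.
  exact/PM/Pp.
by rewrite NegzE mulrNz -mulNrz; apply: PM; rewrite -bpureNl.
Qed.

Section Lift.
Variables (Z : zmodType) (f : N -> M -> Z).

Definition balanced : Prop :=
  [/\ forall m, {morph f^~ m : x y / x + y},
      forall n, {morph f n : x y / x + y}
    & forall n r m, f (ract n r) m = f n (lact r m)].

Definition bsum : {freeg (N * M)%type / int} -> Z :=
  fglift (fun p : (N * M)%type => f p.1 p.2 : zmodule Z).

(** The additive map with [n \ox m |-> f n m]; well defined only when [f] is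
    balanced, see [bliftE]. *)
Definition blift (u : btensor) : Z := bsum (repr u).

Lemma bsumB x y : bsum (x - y) = bsum x - bsum y.
Proof. by rewrite /bsum lift_is_additive. Qed.

Lemma bsumU n m : bsum (bgen n m) = f n m.
Proof. by rewrite /bsum /bgen liftU /= scale1r. Qed.

Hypothesis fb : balanced.

Lemma bsum_rel x : btensor_rel x -> bsum x = 0.
Proof.
case: fb => fl fr fa; elim=> [|{}x y _ hx _ hy|n1 n2 m|n m1 m2|n r m].
- by rewrite -[X in bsum X](subrr 0) bsumB subrr.
- by rewrite bsumB hx hy subrr.
- by rewrite !bsumB !bsumU fl addrAC addrK subrr.
- by rewrite !bsumB !bsumU fr addrAC addrK subrr.
- by rewrite !bsumB !bsumU fa subrr.
Qed.

Lemma blift_pi x : blift (\pi_btensor x) = bsum x.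
Proof.
apply/eqP; rewrite -subr_eq0 -bsumB; apply/eqP/bsum_rel/asboolP.
have := reprK (\pi_btensor x).
by move/eqmodP; rewrite /= /Quotient.equiv.
Qed.

Lemma bliftE n m : blift (bpure n m) = f n m.
Proof. by rewrite blift_pi bsumU. Qed.

Lemma bliftB u v : blift (u - v) = blift u - blift v.
Proof.
rewrite -[u in LHS]reprK -[v in LHS]reprK -raddfB.
by rewrite blift_pi bsumB.
Qed.

Lemma blift0 : blift 0 = 0.
Proof. by rewrite -[X in blift X](subrr 0) bliftB subrr. Qed.

Lemma bliftD u v : blift (u + v) = blift u + blift v.
Proof. by rewrite -[v in LHS]opprK -[- v]sub0r !bliftB blift0 sub0r opprK. Qed.

End Lift.
End BalancedTensor.

(** Elaboration slows down badly if unification unfolds the quotient. *)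
Global Opaque btensor.

Section Tensor.
Variables (k : fieldType) (U V : lmodType k).

Definition tensor : Type :=
  btensor (fun (u : U) (c : k) => c *: u) (fun (c : k) (v : V) => c *: v).

HB.instance Definition _ := GRing.Zmodule.on tensor.

Definition tpure (u : U) (v : V) : tensor := bpure _ _ u v.

Local Notation "x \ox y" := (tpure x y).

Lemma tpureDl u1 u2 v : (u1 + u2) \ox v = u1 \ox v + u2 \ox v.
Proof. exact: bpureDl. Qed.

Lemma tpureDr u v1 v2 : u \ox (v1 + v2) = u \ox v1 + u \ox v2.
Proof. exact: bpureDr. Qed.

Lemma tpureA c u v : (c *: u) \ox v = u \ox (c *: v).
Proof. exact: bpureA. Qed.

Lemma tensor_ind (P : tensor -> Prop) : P 0 ->
  (forall u v, P u -> P v -> P (u + v)) -> (forall u v, P (u \ox v)) ->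
  forall u, P u.
Proof. exact: btensor_ind. Qed.

Section TLift.
Variables (Z : zmodType) (f : U -> V -> Z).

Definition tbalanced : Prop :=
  [/\ forall v, {morph f^~ v : x y / x + y},
      forall u, {morph f u : x y / x + y}
    & forall c u v, f (c *: u) v = f u (c *: v)].

(** The additive map with [u \ox v |-> f u v], for balanced [f]. *)
Definition tlift (t : tensor) : Z := blift f t.

Hypothesis fb : tbalanced.

Let fb' : balanced (fun (u : U) (c : k) => c *: u)
  (fun (c : k) (v : V) => c *: v) f.
Proof. by case: fb => fl fr fa; split=> // u c v; exact: fa. Qed.

Lemma tliftE u v : tlift (u \ox v) = f u v.
Proof. exact: bliftE fb' _ _. Qed.

Lemma tlift0 : tlift 0 = 0.
Proof. exact: blift0 fb'. Qed.

Lemma tliftD x y : tlift (x + y) = tlift x + tlift y.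
Proof. exact: bliftD fb' _ _. Qed.

End TLift.

Definition tscale (c : k) : tensor -> tensor :=
  tlift (fun u v => (c *: u) \ox v).

Fact tscale_balanced c : tbalanced (fun u v => (c *: u) \ox v).
Proof.
split=> [v x y|u x y|d u v]; first by rewrite scalerDr tpureDl.
  exact: tpureDr.
by rewrite scalerA mulrC -scalerA tpureA.
Qed.

Fact tscaleE c u v : tscale c (u \ox v) = (c *: u) \ox v.
Proof. exact: tliftE (tscale_balanced c) _ _. Qed.

Fact tscaleDr c : {morph tscale c : x y / x + y}.
Proof. exact: tliftD (tscale_balanced c). Qed.

Fact tscale0 c : tscale c 0 = 0.
Proof. exact: tlift0 (tscale_balanced c). Qed.

Fact tscaleA a b x : tscale a (tscale b x) = tscale (a * b) x.
Proof.
elim/tensor_ind: x => [|x y IHx IHy|u v]; first by rewrite !tscale0.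
  by rewrite !tscaleDr IHx IHy.
by rewrite !tscaleE scalerA.
Qed.

Fact tscale1 : left_id 1 tscale.
Proof.
elim/tensor_ind=> [|x y IHx IHy|u v]; first by rewrite tscale0.
  by rewrite tscaleDr IHx IHy.
by rewrite tscaleE scale1r.
Qed.

Fact tscaleDl x a b : tscale (a + b) x = tscale a x + tscale b x.
Proof.
elim/tensor_ind: x => [|x y IHx IHy|u v]; first by rewrite !tscale0 addr0.
  by rewrite !tscaleDr IHx IHy addrACA.
by rewrite !tscaleE scalerDl tpureDl.
Qed.

HB.instance Definition _ := GRing.Zmodule_isLmodule.Build k tensor
  tscaleA tscale1 tscaleDr tscaleDl.

Lemma tpureZl c u v : (c *: u) \ox v = c *: (u \ox v).
Proof. by rewrite -tscaleE. Qed.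

Lemma tpureZr c u v : u \ox (c *: v) = c *: (u \ox v).
Proof. by rewrite -tpureA tpureZl. Qed.

End Tensor.

Notation "U \ox V" := (tensor U%type V%type) : type_scope.
Notation "u \ox v" := (tpure u v) : ring_scope.

Lemma bilin_balanced (k : fieldType) (U V W : lmodType k) (f : U -> V -> W) :
  (forall v, linear (f^~ v)) -> (forall u, linear (f u)) -> tbalanced f.
Proof.
move=> fl fr; split=> [v x y|u x y|c u v].
- by have /= := fl v 1 x y; rewrite !scale1r.
- by have := fr u 1 x y; rewrite !scale1r.
have f0 v' : f 0 v' = 0.
  by have /= := fl v' (-1) 0 0; rewrite !scaleN1r !addNr.
have f0' u' : f u' 0 = 0.
  by have /= := fr u' (-1) 0 0; rewrite !scaleN1r !addNr.
have /= := fl v c u 0; rewrite addr0 f0 addr0 => ->.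
by have := fr u c v 0; rewrite addr0 f0' addr0 => ->.
Qed.

Lemma tlift_linear (k : fieldType) (U V W : lmodType k) (f : U -> V -> W) :
  (forall v, linear (f^~ v)) -> (forall u, linear (f u)) -> linear (tlift f).
Proof.
move=> fl fr; have fb := bilin_balanced fl fr.
move=> c x y; rewrite tliftD //; congr (_ + _).
have f0 v : f 0 v = 0.
  by have /= := fl v (-1) 0 0; rewrite !scaleN1r !addNr.
elim/tensor_ind: x => [|x z IHx IHz|u v].
- by rewrite scaler0 tlift0 // scaler0.
- by rewrite scalerDr !tliftD // IHx IHz scalerDr.
- rewrite -tpureZl !tliftE //.
  by have /= := fl v c u 0; rewrite !addr0 f0 addr0.
Qed.

Section TensorMaps.
Variable k : fieldType.

Section Tmap.
Variables (U V U' V' : lmodType k).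

Definition tmap (f : U -> U') (g : V -> V') : U \ox V -> U' \ox V' :=
  tlift (fun u v => f u \ox g v).

Variables (f : {linear U -> U'}) (g : {linear V -> V'}).

Fact tmap_bilin : (forall v, linear (fun u => f u \ox g v)) /\
  (forall u, linear (fun v => f u \ox g v)).
Proof.
split=> [v c x y|u c x y]; rewrite linearP ?tpureDl ?tpureDr ?tpureZl ?tpureZr //.
Qed.

Lemma tmapE u v : tmap f g (u \ox v) = f u \ox g v.
Proof. by rewrite [LHS]tliftE //; apply: bilin_balanced; apply tmap_bilin. Qed.

Fact tmap_linear : linear (tmap f g).
Proof. by apply: tlift_linear; apply tmap_bilin. Qed.

HB.instance Definition _ :=
  GRing.isLinear.Build k (U \ox V)%type (U' \ox V')%type *:%R (tmap f g) tmap_linear.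

End Tmap.

Section Flip.
Variables U V : lmodType k.

Definition tflip : U \ox V -> V \ox U := tlift (fun u v => v \ox u).

Fact tflip_bilin : (forall v : V, linear (fun u : U => v \ox u)) /\
  (forall u : U, linear (fun v : V => v \ox u)).
Proof. by split=> [v c x y|u c x y]; rewrite ?tpureDl ?tpureDr ?tpureZl ?tpureZr. Qed.

Lemma tflipE u v : tflip (u \ox v) = v \ox u.
Proof. by rewrite [LHS]tliftE //; apply: bilin_balanced; apply tflip_bilin. Qed.

Fact tflip_linear : linear tflip.
Proof. by apply: tlift_linear; apply tflip_bilin. Qed.

HB.instance Definition _ :=
  GRing.isLinear.Build k (U \ox V)%type (V \ox U)%type *:%R tflip tflip_linear.

End Flip.

Section Assoc.
Variables U V W : lmodType k.

Definition tassoc : U \ox (V \ox W) -> U \ox V \ox W :=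
  tlift (fun u => tlift (fun v w => u \ox v \ox w)).

Fact tassoc_bilin_in u : (forall w : W, linear (fun v : V => u \ox v \ox w)) /\
  (forall v : V, linear (fun w : W => (u : U) \ox v \ox w)).
Proof.
by split=> [w c x y|v c x y]; rewrite ?tpureDr ?tpureZr ?tpureDl ?tpureZl.
Qed.

Fact tassoc_in_linear u : linear (tlift (fun (v : V) (w : W) => (u : U) \ox v \ox w)).
Proof. by apply: tlift_linear; apply tassoc_bilin_in. Qed.

Let in_balanced u : tbalanced (fun (v : V) (w : W) => (u : U) \ox v \ox w).
Proof. by apply: bilin_balanced; apply tassoc_bilin_in. Qed.

Fact tassoc_bilin :
  (forall t : V \ox W, linear (fun u : U => tlift (fun v w => u \ox v \ox w) t)) /\
  (forall u : U, linear (tlift (fun (v : V) (w : W) => u \ox v \ox w))).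
Proof.
split=> [t c x y|]; last exact: tassoc_in_linear.
elim/tensor_ind: t => [|s t IHs IHt|v w].
- by rewrite !tlift0 // scaler0 addr0.
- by rewrite !tliftD // IHs IHt scalerDr addrACA.
- by rewrite !tliftE // tpureDl tpureZl tpureDl tpureZl.
Qed.

Lemma tassocE u v w : tassoc (u \ox (v \ox w)) = u \ox v \ox w.
Proof.
rewrite [LHS]tliftE; first by rewrite tliftE.
by apply: bilin_balanced; apply tassoc_bilin.
Qed.

Fact tassoc_linear : linear tassoc.
Proof. by apply: tlift_linear; apply tassoc_bilin. Qed.

HB.instance Definition _ := GRing.isLinear.Build k
  (U \ox (V \ox W))%type (U \ox V \ox W)%type *:%R tassoc tassoc_linear.

End Assoc.

End TensorMaps.

(** Nonzero vectors are separated from 0 by linear forms; used to see that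
    [1 \ox 1] is nonzero. *)
Lemma linear_form_exists (k : fieldType) (V : lmodType k) (v : V) : v != 0 ->
  exists2 f : V -> k, (forall c x y, f (c *: x + y) = c * f x + f y) & f v = 1.
Proof.
move=> v0.
pose lin (W : set V) := forall c x y, W x -> W y -> W (c *: x + y).
have [F FP Ftot|W [[Wlin Wv] Wmax]] :=
  @Zorn_bigcup V [set W | lin W /\ ~ W v]%classic.
  split=> [c x y [X FX Xx] [Y FY Yy]|[X FX]]; last by have [] := FP X FX.
  have [XY|YX] := Ftot X Y FX FY.
    by exists Y => //; apply: (FP Y FY).1 => //; exact: XY.
  by exists X => //; apply: (FP X FX).1 => //; exact: YX.
pose B a := [set u | exists c w, (W w \/ w = 0) /\ u = w + c *: a]%classic.
have Blin a : lin (B a).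
  move=> c _ _ [d [w [Ww ->]]] [e [w' [Ww' ->]]].
  exists (c * d + e), (c *: w + w'); split; last first.
    by rewrite scalerDr scalerA scalerDl addrACA.
  case: Ww Ww' => [Ww|->] [Ww'|->]; rewrite ?scaler0 ?addr0 ?add0r.
  - by left; exact: Wlin.
  - left; have W0 : W 0 by have := Wlin (-1) w w Ww Ww; rewrite scaleN1r addNr.
    by have := Wlin c w 0 Ww W0; rewrite addr0.
  - by left.
  - by right.
have BW a x : W x -> B a x.
  by move=> Wx; exists 0, x; split; [left|rewrite scale0r addr0].
have Ba a : B a a by exists 1, 0; split; [right|rewrite scale1r add0r].
have W0 : W 0.
  case: (pselect (W 0)) => // nW0.
  have W_B : (W `<` B 0)%classic.
    split=> [x|sub]; first exact: BW.
    by apply: nW0; apply: sub; exact: Ba.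
  exfalso; apply: (Wmax _ W_B); split; first exact: Blin.
  case=> c [w [[Ww|->]]]; rewrite scaler0 addr0 => vw; last by rewrite vw eqxx in v0.
  by rewrite vw in Wv.
have WZ c x : W x -> W (c *: x) by move=> Wx; rewrite -[_ *: _]addr0; exact: Wlin.
have dec a : exists c, W (a - c *: v).
  case: (pselect (W a)) => [Wa|nWa]; first by exists 0; rewrite scale0r subr0.
  have W_B : (W `<` B a)%classic.
    split=> [x|sub]; first exact: BW.
    by apply: nWa; apply: sub; exact: Ba.
  case: (pselect (B a v)) => [[c [w [Ww vE]]]|nBv]; last first.
    by exfalso; apply: (Wmax _ W_B); split; [exact: Blin|].
  have {}Ww : W w by case: Ww => [|->].
  have c0 : c != 0.
    by apply/eqP=> c0; apply: Wv; rewrite vE c0 scale0r addr0.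
  exists c^-1; rewrite vE scalerDr scalerA mulVf // scale1r opprD addrCA subrr addr0.
  by rewrite -scaleN1r; exact/WZ/WZ.
have uniq_c a c d : W (a - c *: v) -> W (a - d *: v) -> c = d.
  move=> hc hd; apply/eqP; rewrite -subr_eq0; apply: contra_notT Wv => cd.
  rewrite -[v]scale1r -(mulVf cd) -scalerA; apply: WZ.
  have -> : (c - d) *: v = (-1) *: (a - c *: v) + (a - d *: v).
    by rewrite scaleN1r opprB addrA subrK scalerBl.
  exact: Wlin.
have [f fP] := choice dec.
exists f => [c x y|]; last by apply: (uniq_c v); rewrite ?scale1r ?subrr.
apply: (uniq_c (c *: x + y)); first exact: fP.
have -> : c *: x + y - (c * f x + f y) *: v = c *: (x - f x *: v) + (y - f y *: v).
  by rewrite scalerDl opprD addrACA -scalerA scalerBr.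
exact: Wlin.
Qed.

Section TensorAlgebra.
Variables (k : fieldType) (A B : algType k).

Definition tmul (x y : A \ox B) : A \ox B :=
  tlift (fun a b => tlift (fun c d => (a * c) \ox (b * d)) y) x.

Let tmul_bilin_in (a : A) (b : B) :
  (forall d : B, linear (fun c : A => (a * c) \ox (b * d))) /\
  (forall c : A, linear (fun d : B => (a * c) \ox (b * d))).
Proof.
split=> [d|c] e x y; rewrite mulrDr -scalerAr ?tpureDl ?tpureDr.
  by rewrite tpureZl.
by rewrite tpureZr.
Qed.

Let in_balanced (a : A) (b : B) :
  tbalanced (fun (c : A) (d : B) => (a * c) \ox (b * d)).
Proof. by apply: bilin_balanced; apply tmul_bilin_in. Qed.

Let tmul_bilin (y : A \ox B) :
  (forall b : B, linear (fun a : A => tlift (fun c d => (a * c) \ox (b * d)) y)) /\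
  (forall a : A, linear (fun b : B => tlift (fun c d => (a * c) \ox (b * d)) y)).
Proof.
split=> [b|a] e u v.
  elim/tensor_ind: y => [|s t IHs IHt|c d].
  - by rewrite !tlift0 // scaler0 addr0.
  - by rewrite !tliftD // IHs IHt scalerDr addrACA.
  - by rewrite !tliftE // mulrDl -scalerAl tpureDl tpureZl.
elim/tensor_ind: y => [|s t IHs IHt|c d].
- by rewrite !tlift0 // scaler0 addr0.
- by rewrite !tliftD // IHs IHt scalerDr addrACA.
- by rewrite !tliftE // mulrDl -scalerAl tpureDr tpureZr.
Qed.

Let tmul_balanced y :
  tbalanced (fun (a : A) (b : B) => tlift (fun c d => (a * c) \ox (b * d)) y).
Proof. by apply: bilin_balanced; apply (tmul_bilin y). Qed.

Fact tmul_pure a b c d : tmul (a \ox b) (c \ox d) = (a * c) \ox (b * d).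
Proof. by rewrite /tmul !tliftE. Qed.

Fact tmulDl : left_distributive tmul +%R.
Proof. by move=> x y z; rewrite /tmul tliftD. Qed.

Fact tmul0 x : tmul 0 x = 0.
Proof. exact: tlift0. Qed.

Fact tmulr0 x : tmul x 0 = 0.
Proof.
elim/tensor_ind: x => [|x y IHx IHy|a b]; first exact: tmul0.
  by rewrite tmulDl IHx IHy addr0.
by rewrite /tmul tliftE // tlift0.
Qed.

Fact tmulDr : right_distributive tmul +%R.
Proof.
move=> x y z; elim/tensor_ind: x => [|s t IHs IHt|a b].
- by rewrite !tmul0 addr0.
- by rewrite !tmulDl IHs IHt addrACA.
- by rewrite /tmul !tliftE // tliftD.
Qed.

Fact tmulZl c x y : tmul (c *: x) y = c *: tmul x y.
Proof.
have h := tlift_linear (tmul_bilin y).1 (tmul_bilin y).2.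
by have := h c x 0; rewrite addr0 (tlift0 (tmul_balanced y)) addr0.
Qed.

Fact tmulZr c x y : tmul x (c *: y) = c *: tmul x y.
Proof.
elim/tensor_ind: x => [|s t IHs IHt|a b].
- by rewrite !tmul0 scaler0.
- by rewrite !tmulDl IHs IHt scalerDr.
rewrite /tmul !(tliftE (tmul_balanced _)).
have h := tlift_linear (tmul_bilin_in a b).1 (tmul_bilin_in a b).2.
by have := h c y 0; rewrite addr0 (tlift0 (in_balanced a b)) addr0.
Qed.

Fact tmulA : associative tmul.
Proof.
move=> x y z; elim/tensor_ind: x => [|s t IHs IHt|a b].
- by rewrite !tmul0.
- by rewrite !tmulDl IHs IHt.
elim/tensor_ind: y => [|s t IHs IHt|c d].
- by rewrite !(tmulr0, tmul0).
- by rewrite !(tmulDl, tmulDr) IHs IHt.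
elim/tensor_ind: z => [|s t IHs IHt|e f].
- by rewrite !tmulr0.
- by rewrite !tmulDr IHs IHt.
- by rewrite !tmul_pure !mulrA.
Qed.

Fact tmul1l : left_id (1 \ox 1) tmul.
Proof.
elim/tensor_ind=> [|s t IHs IHt|a b]; first exact: tmulr0.
  by rewrite tmulDr IHs IHt.
by rewrite tmul_pure !mul1r.
Qed.

Fact tmul1r : right_id (1 \ox 1) tmul.
Proof.
elim/tensor_ind=> [|s t IHs IHt|a b]; first exact: tmul0.
  by rewrite tmulDl IHs IHt.
by rewrite tmul_pure !mulr1.
Qed.

Fact tone_neq0 : 1 \ox 1 != 0 :> A \ox B.
Proof.
have [f fl f1] := linear_form_exists (oner_neq0 A).
have [g gl g1] := linear_form_exists (oner_neq0 B).
pose h (a : A) (b : B) : k^o := f a * g b.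
have hb : tbalanced h.
  apply: bilin_balanced => [b|a] c x y; rewrite /h ?fl ?gl.
    by rewrite mulrDl -mulrA.
  by rewrite mulrDr mulrCA.
apply/eqP=> /(congr1 (tlift h)); rewrite tliftE // tlift0 // /h f1 g1 mulr1.
by apply/eqP; exact: oner_neq0.
Qed.

HB.instance Definition _ := GRing.Zmodule_isNzRing.Build (A \ox B)%type
  tmulA tmul1l tmul1r tmulDl tmulDr tone_neq0.

HB.instance Definition _ :=
  GRing.LSemiModule_isLSemiAlgebra.Build k (A \ox B)%type
    (fun c x y => esym (tmulZl c x y)).

HB.instance Definition _ :=
  GRing.LSemiAlgebra_isSemiAlgebra.Build k (A \ox B)%type
    (fun c x y => esym (tmulZr c x y)).

Lemma tpureM (a c : A) (b d : B) :
  (a \ox b) * (c \ox d) = (a * c) \ox (b * d).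
Proof. exact: tmul_pure. Qed.

Lemma tensor1E : 1 = 1 \ox 1 :> A \ox B. Proof. by []. Qed.

End TensorAlgebra.

Section TensorAlgebraMaps.
Variables (k : fieldType).

Lemma tensor_monoid (A B C : algType k) (h : {linear (A \ox B)%type -> C}) :
  h (1 \ox 1) = 1 ->
  (forall a b c d, h ((a * c) \ox (b * d)) = h (a \ox b) * h (c \ox d)) ->
  monoid_morphism h.
Proof.
move=> h1 hM; split=> [//|x y].
have h0 : h 0 = 0 by exact: raddf0.
have hD u v : h (u + v) = h u + h v by exact: raddfD.
elim/tensor_ind: x => [|s t IHs IHt|a b].
- by rewrite mul0r h0 mul0r.
- by rewrite mulrDl !hD mulrDl IHs IHt.
elim/tensor_ind: y => [|s t IHs IHt|c d].
- by rewrite mulr0 h0 mulr0.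
- by rewrite mulrDr !hD mulrDr IHs IHt.
- by rewrite tpureM hM.
Qed.

Lemma tmap_monoid (A B A' B' : algType k) (f : {lrmorphism A -> A'})
  (g : {lrmorphism B -> B'}) : monoid_morphism (tmap f g).
Proof.
apply: tensor_monoid => [|a b c d]; first by rewrite [LHS]tmapE !rmorph1.
by rewrite [LHS]tmapE [X in _ = X * _]tmapE [X in _ = _ * X]tmapE !rmorphM tpureM.
Qed.

HB.instance Definition _ (A B A' B' : algType k) (f : {lrmorphism A -> A'})
    (g : {lrmorphism B -> B'}) :=
  GRing.isMonoidMorphism.Build (A \ox B)%type (A' \ox B')%type (tmap f g)
    (tmap_monoid f g).

Lemma tflip_monoid (A B : algType k) : monoid_morphism (@tflip k A B).
Proof.
apply: tensor_monoid => [|a b c d]; first by rewrite [LHS]tflipE.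
by rewrite [LHS]tflipE [X in _ = X * _]tflipE [X in _ = _ * X]tflipE tpureM.
Qed.

HB.instance Definition _ (A B : algType k) :=
  GRing.isMonoidMorphism.Build (A \ox B)%type (B \ox A)%type (@tflip k A B)
    (tflip_monoid A B).

Lemma tassoc_monoid (A B C : algType k) : monoid_morphism (@tassoc k A B C).
Proof.
have [h hE] : {h | h = @tassoc k A B C} by exists (@tassoc k A B C).
have hD x y : h (x + y) = h x + h y by rewrite hE; exact: raddfD.
have h0 (a : A) : h (a \ox 0) = 0.
  have -> : a \ox 0 = 0 :> (A \ox (B \ox C))%type.
    by apply: (addrI (a \ox 0)); rewrite -tpureDr !addr0.
  by apply: (addrI (h 0)); rewrite -hD !addr0.
suff key a u c v : h ((a * c) \ox (u * v)) = h (a \ox u) * h (c \ox v).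
  apply: tensor_monoid => [|a u c v]; first exact: tassocE.
  by rewrite hE in key; exact: key.
have hp (a' : A) (b : B) (e : C) : h (a' \ox (b \ox e)) = a' \ox b \ox e.
  by rewrite hE tassocE.
elim/tensor_ind: u => [|s t IHs IHt|b e].
- by rewrite mul0r !h0 mul0r.
- by rewrite mulrDl !tpureDr !hD mulrDl IHs IHt.
elim/tensor_ind: v => [|s t IHs IHt|b' e'].
- by rewrite mulr0 !h0 mulr0.
- by rewrite mulrDr !tpureDr !hD mulrDr IHs IHt.
- by rewrite tpureM !hp !tpureM.
Qed.

HB.instance Definition _ (A B C : algType k) := GRing.isMonoidMorphism.Build
  (A \ox (B \ox C))%type (A \ox B \ox C)%type (@tassoc k A B C)
  (tassoc_monoid A B C).

End TensorAlgebraMaps.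

(** For [phi : R -> X] multiplicative, X is a right R-module via
    [x . r = x * phi r], and [basechange phi M] is the left X-module
    X \ox_R M. *)

Section BaseChange.
Variables (R X : nzRingType) (phi : R -> X) (M : lmodType R).

Definition basechange : Type :=
  btensor (fun (x : X) (r : R) => x * phi r) (fun (r : R) (m : M) => r *: m).

HB.instance Definition _ := GRing.Zmodule.on basechange.

Definition bcpure (x : X) (m : M) : basechange := bpure _ _ x m.

Lemma bcpureDl x1 x2 m : bcpure (x1 + x2) m = bcpure x1 m + bcpure x2 m.
Proof. exact: bpureDl. Qed.

Lemma bcpureDr x m1 m2 : bcpure x (m1 + m2) = bcpure x m1 + bcpure x m2.
Proof. exact: bpureDr. Qed.

Lemma bcpureA x r m : bcpure (x * phi r) m = bcpure x (r *: m).
Proof. exact: bpureA. Qed.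

Lemma basechange_ind (P : basechange -> Prop) : P 0 ->
  (forall u v, P u -> P v -> P (u + v)) -> (forall x m, P (bcpure x m)) ->
  forall u, P u.
Proof. exact: btensor_ind. Qed.

Section BCLift.
Variables (Z : zmodType) (f : X -> M -> Z).

Definition bcbalanced : Prop :=
  [/\ forall m, {morph f^~ m : x y / x + y},
      forall x, {morph f x : m n / m + n}
    & forall x r m, f (x * phi r) m = f x (r *: m)].

(** The additive map with [x \ox_R m |-> f x m], for balanced [f]. *)
Definition bclift (u : basechange) : Z := blift f u.

Hypothesis fb : bcbalanced.

Lemma bcliftE x m : bclift (bcpure x m) = f x m.
Proof. exact: bliftE. Qed.

Lemma bclift0 : bclift 0 = 0.
Proof. exact: blift0. Qed.

Lemma bcliftD u v : bclift (u + v) = bclift u + bclift v.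
Proof. exact: bliftD. Qed.

End BCLift.

Definition bcscale (a : X) : basechange -> basechange :=
  bclift (fun x m => bcpure (a * x) m).

Fact bcscale_balanced a : bcbalanced (fun x m => bcpure (a * x) m).
Proof.
split=> [m x y|x m n|x r m]; first by rewrite mulrDr bcpureDl.
  exact: bcpureDr.
by rewrite mulrA bcpureA.
Qed.

Fact bcscaleE a x m : bcscale a (bcpure x m) = bcpure (a * x) m.
Proof. exact: bcliftE (bcscale_balanced a) _ _. Qed.

Fact bcscaleDr a : {morph bcscale a : x y / x + y}.
Proof. exact: bcliftD (bcscale_balanced a). Qed.

Fact bcscale0 a : bcscale a 0 = 0.
Proof. exact: bclift0 (bcscale_balanced a). Qed.

Fact bcscaleA a b u : bcscale a (bcscale b u) = bcscale (a * b) u.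
Proof.
elim/basechange_ind: u => [|u v IHu IHv|x m]; first by rewrite !bcscale0.
  by rewrite !bcscaleDr IHu IHv.
by rewrite !bcscaleE mulrA.
Qed.

Fact bcscale1 : left_id 1 bcscale.
Proof.
elim/basechange_ind=> [|u v IHu IHv|x m]; first by rewrite bcscale0.
  by rewrite bcscaleDr IHu IHv.
by rewrite bcscaleE mul1r.
Qed.

Fact bcscaleDl u a b : bcscale (a + b) u = bcscale a u + bcscale b u.
Proof.
elim/basechange_ind: u => [|u v IHu IHv|x m]; first by rewrite !bcscale0 addr0.
  by rewrite !bcscaleDr IHu IHv addrACA.
by rewrite !bcscaleE mulrDl bcpureDl.
Qed.

HB.instance Definition _ := GRing.Zmodule_isLmodule.Build X basechange
  bcscaleA bcscale1 bcscaleDr bcscaleDl.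

Lemma bcpureZ a x m : a *: bcpure x m = bcpure (a * x) m.
Proof. exact: bcscaleE. Qed.

End BaseChange.

Section BaseChangeMap.
Variables (R X Y : nzRingType) (phi : R -> X) (psi : R -> Y) (M : lmodType R).
Variable f : X -> Y.

(** f \ox_R id_M, well defined when [f] is additive and
    [f (x * phi r) = f x * psi r]. *)
Definition bcmap : basechange phi M -> basechange psi M :=
  bclift (fun x m => bcpure psi (f x) m).

Hypothesis fD : {morph f : x y / x + y}.
Hypothesis fR : forall x r, f (x * phi r) = f x * psi r.

Let fb : bcbalanced phi (fun x (m : M) => bcpure psi (f x) m).
Proof.
split=> [m x y|x m n|x r m]; first by rewrite fD bcpureDl.
  exact: bcpureDr.
by rewrite fR bcpureA.
Qed.

Lemma bcmapE x m : bcmap (bcpure phi x m) = bcpure psi (f x) m.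
Proof. exact: bcliftE. Qed.

Lemma bcmap0 : bcmap 0 = 0.
Proof. exact: bclift0. Qed.

Lemma bcmapD : {morph bcmap : u v / u + v}.
Proof. exact: bcliftD. Qed.

Hypothesis fM : {morph f : x y / x * y}.

Lemma bcmapZ a u : bcmap (a *: u) = f a *: bcmap u.
Proof.
elim/basechange_ind: u => [|u v IHu IHv|x m].
- by rewrite scaler0 bcmap0 scaler0.
- by rewrite scalerDr !bcmapD IHu IHv scalerDr.
- by rewrite bcpureZ !bcmapE fM bcpureZ.
Qed.

End BaseChangeMap.

Arguments bcmap {R X Y} phi psi {M} f u.

HB.mixin Record isHopf (k : fieldType) H of GRing.Algebra k H := {
  comul : {lrmorphism H -> (H \ox H)%type};
  counit : {lrmorphism H -> k^o};
  antipode : {linear H -> H};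
  comulA : forall h : H,
    tmap comul idfun (comul h) = tassoc (tmap idfun comul (comul h));
  counitl : forall h : H, tlift (fun a b : H => counit a *: b) (comul h) = h;
  counitr : forall h : H, tlift (fun a b : H => counit b *: a) (comul h) = h;
  antipodel : forall h : H,
    tlift (fun a b : H => antipode a * b) (comul h) = (counit h)%:A;
  antipoder : forall h : H,
    tlift (fun a b : H => a * antipode b) (comul h) = (counit h)%:A
}.

#[short(type="hopfAlgType")]
HB.structure Definition Hopf (k : fieldType) :=
  {H of GRing.Algebra k H & isHopf k H}.

Definition cocommutative (k : fieldType) (H : hopfAlgType k) : Prop :=
  forall h : H, tflip (comul h) = comul h.

Section HTensor.
Variables (k : fieldType) (H : hopfAlgType k).

Definition H2 : algType k := (H \ox H)%type.
Definition H3 : algType k := (H \ox H \ox H)%type.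

(** The iterated comultiplication [(comul \ox id) comul], through which
    [H \ox H \ox H] is a right H-module. *)
Definition comul3 (h : H) : H3 := tmap comul idfun (comul h).

(** H3 is bracketed to the left, so [id \ox comul] and, below, [1 \ox F] have
    to be reassociated by [tassoc]. *)
Definition comul_l : H2 -> H3 := tmap comul idfun.
Definition comul_r (F : H2) : H3 := tassoc (tmap idfun comul F).

Definition ins_r (F : H2) : H3 := F \ox (1 : H).
Definition ins_l (F : H2) : H3 := tassoc ((1 : H) \ox F).

Definition swap12 : H3 -> H3 := tmap (@tflip k H H) idfun.

Section Modules.
Variable M : lmodType H.

Definition H2mod : lmodType H2 := basechange (comul : H -> H2) M.
Definition H3mod : lmodType H3 := basechange comul3 M.

Definition sigma_id : H2mod -> H2mod := bcmap comul comul (@tflip k H H).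
Definition swap12_id : H3mod -> H3mod := bcmap comul3 comul3 swap12.

End Modules.

(** Maps out of L \ox_k M are curried. The scalars of k act on an H-module
    through [c%:A], so k-bilinearity is additivity together with the case
    [f, g \in k%:A] of the last clause. *)
Definition H2linear (L M N : lmodType H) (mu : L -> M -> H2mod N) : Prop :=
  [/\ forall b, {morph mu^~ b : x y / x + y},
      forall a, {morph mu a : x y / x + y}
    & forall (f g : H) a b, mu (f *: a) (g *: b) = ((f \ox g) : H2) *: mu a b].

(** [comp_l mu u y] is mu(u, y) for [u] in H2 \ox_H L and [comp_r mu x v] is
    mu(x, v) for [v] in H2 \ox_H M; see [comp_lE] and [comp_rE]. *)
Section Composition.
Variables (L M N : lmodType H) (mu : L -> M -> H2mod N).

Definition comp_l (u : H2mod L) (y : M) : H3mod N :=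
  bclift (fun (F : H2) (x : L) =>
    ins_r F *: (bcmap comul comul3 comul_l (mu x y) : H3mod N)) u.

Definition comp_r (x : L) (v : H2mod M) : H3mod N :=
  bclift (fun (F : H2) (y : M) =>
    ins_l F *: (bcmap comul comul3 comul_r (mu x y) : H3mod N)) v.

End Composition.

Fact comul_lD : {morph comul_l : F G / F + G}.
Proof. exact: raddfD. Qed.

Fact comul_lM : {morph comul_l : F G / F * G}.
Proof. exact: rmorphM. Qed.

Fact comul_l_comul F (h : H) : comul_l (F * comul h) = comul_l F * comul3 h.
Proof. exact: comul_lM. Qed.

Fact comul_l_pure f g : comul_l (f \ox g) = comul f \ox g.
Proof. exact: tmapE. Qed.

Fact comul_rD : {morph comul_r : F G / F + G}.
Proof.
have h : {morph tmap (@idfun H) (@comul k H) : F G / F + G} by exact: raddfD.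
by move=> F G; rewrite /comul_r h; exact: raddfD.
Qed.

Fact comul_rM : {morph comul_r : F G / F * G}.
Proof.
have h : {morph tmap (@idfun H) (@comul k H) : F G / F * G} by exact: rmorphM.
by move=> F G; rewrite /comul_r h; exact: rmorphM.
Qed.

Fact comul_r_comul F (h : H) : comul_r (F * comul h) = comul_r F * comul3 h.
Proof. by rewrite comul_rM /comul3 comulA. Qed.

Fact comul_r_pure f g : comul_r (f \ox g) = tassoc (f \ox comul g).
Proof. by rewrite /comul_r tmapE. Qed.

Fact ins_rM : {morph ins_r : F G / F * G}.
Proof. by move=> F G; rewrite /ins_r tpureM mul1r. Qed.

Fact ins_rD : {morph ins_r : F G / F + G}.
Proof. by move=> F G; rewrite /ins_r tpureDl. Qed.

Fact ins_lM : {morph ins_l : F G / F * G}.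
Proof.
move=> F G; rewrite /ins_l -[X in X \ox _](mul1r 1) -tpureM.
exact: rmorphM.
Qed.

Fact ins_lD : {morph ins_l : F G / F + G}.
Proof. by move=> F G; rewrite /ins_l tpureDr; exact: raddfD. Qed.

Section Cocommutative.
Hypothesis Hcc : cocommutative H.

Fact tflip_comul (F : H2) (h : H) :
  tflip (F * comul h) = tflip F * comul h :> H2.
Proof.
have tM : {morph @tflip k H H : F G / (F * G)} by exact: rmorphM.
by rewrite tM; congr (_ * _); exact: Hcc.
Qed.

Fact swap12_comul3 F (h : H) : swap12 (F * comul3 h) = swap12 F * comul3 h.
Proof.
have sM : {morph swap12 : F G / F * G} by exact: rmorphM.
have sD : {morph swap12 : F G / F + G} by exact: raddfD.
have lD : {morph comul_l : F G / F + G} by exact: comul_lD.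
have s0 : swap12 0 = 0 by exact: raddf0.
have l0 : comul_l 0 = 0 by exact: raddf0.
rewrite sM; congr (_ * _); rewrite /comul3 -/(comul_l _).
elim/tensor_ind: (comul h) => [|F1 F2 IH1 IH2|f g].
- by rewrite l0 s0.
- by rewrite lD sD IH1 IH2.
- rewrite comul_l_pure /swap12 tmapE; congr (_ \ox _); exact: Hcc.
Qed.

Variable N : lmodType H.

Lemma sigma_idE F (x : N) :
  sigma_id (bcpure comul F x : H2mod N) = bcpure comul (tflip F) x.
Proof.
apply: bcmapE; [exact: raddfD|exact: tflip_comul].
Qed.

Lemma swap12_idE F (x : N) :
  swap12_id (bcpure comul3 F x : H3mod N) = bcpure comul3 (swap12 F) x.
Proof.
apply: bcmapE; [exact: raddfD|exact: swap12_comul3].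
Qed.

End Cocommutative.

Section CompositionE.
Variables (L M N : lmodType H) (mu : L -> M -> H2mod N).
Hypothesis mulin : H2linear mu.

Lemma comp_lE F x y : comp_l mu (bcpure comul F x) y =
  ins_r F *: (bcmap comul comul3 comul_l (mu x y) : H3mod N).
Proof.
case: mulin => muDl muDr muZ; apply: bcliftE; split=> [{}x F1 F2|{}F x1 x2|{}F r {}x].
- by rewrite ins_rD scalerDl.
- by rewrite muDl (bcmapD comul_lD comul_l_comul) scalerDr.
- rewrite -[y in RHS]scale1r muZ (bcmapZ comul_lD comul_l_comul comul_lM).
  by rewrite scalerA comul_l_pure ins_rM.
Qed.

Lemma comp_rE F x y : comp_r mu x (bcpure comul F y) =
  ins_l F *: (bcmap comul comul3 comul_r (mu x y) : H3mod N).
Proof.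
case: mulin => muDl muDr muZ; apply: bcliftE; split=> [{}y F1 F2|{}F x1 x2|{}F r {}y].
- by rewrite ins_lD scalerDl.
- by rewrite muDr (bcmapD comul_rD comul_r_comul) scalerDr.
- rewrite -[x in RHS]scale1r muZ (bcmapZ comul_rD comul_r_comul comul_rM).
  by rewrite scalerA comul_r_pure ins_lM.
Qed.

End CompositionE.

End HTensor.

Section OmegaPseudoalgebras.
Variables (k : fieldType) (H : hopfAlgType k).
Variables (Omega : Type) (op : SemiGroup.law Omega) (A : lmodType H).

Definition omega_product := Omega -> Omega -> A -> A -> H2mod A.

Implicit Types star bracket : omega_product.

Record omega_associative star : Prop := {
  omega_assoc_linear : forall a b, H2linear (star a b);
  omega_assocA : forall a b c x y z,
    comp_l (star (op a b) c) (star a b x y) z =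
    comp_r (star a (op b c)) x (star b c y z)
}.

Definition omega_commutative star : Prop :=
  forall a b x y, star a b x y = sigma_id (star b a y x).

(** The deformation sum_i T^(i) t^i is given by its coefficients [T i]. *)
Record formal_deformation star (T : nat -> omega_product) : Prop := {
  deformation_linear : forall i a b, H2linear (T i a b);
  deformation0 : forall a b x y, T 0%N a b x y = star a b x y;
  deformationA : forall s a b c x y z,
    \sum_(i < s.+1) comp_r (T i a (op b c)) x (T (s - i)%N b c y z) =
    \sum_(i < s.+1) comp_l (T i (op a b) c) (T (s - i)%N a b x y) z
}.

Record omega_lie bracket : Prop := {
  omega_lie_linear : forall a b, H2linear (bracket a b);
  omega_lie_skew : forall a b x y,
    bracket a b x y = - sigma_id (bracket b a y x);
  omega_lie_jacobi : forall a b c x y z,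
    comp_l (bracket (op a b) c) (bracket a b x y) z =
    comp_r (bracket a (op b c)) x (bracket b c y z) -
    swap12_id (comp_r (bracket b (op a c)) y (bracket a c x z))
}.

Record omega_poisson bracket star : Prop := {
  omega_poisson_lie : omega_lie bracket;
  omega_poisson_assoc : omega_associative star;
  omega_poisson_comm : omega_commutative star;
  omega_poisson_leibniz : forall a b c x y z,
    comp_r (bracket a (op b c)) x (star b c y z) =
    comp_l (star (op a b) c) (bracket a b x y) z +
    swap12_id (comp_r (star b (op a c)) y (bracket a c x z))
}.

End OmegaPseudoalgebras.

(* Main.v *)
Require Import Defs.
From HB Require Import structures.
From mathcomp Require Import all_boot all_algebra.
From mathcomp Require Import boolp.

Set Implicit Arguments.
Unset Strict Implicit.
Unset Printing Implicit Defensive.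

Import GRing.Theory.

Local Open Scope ring_scope.

(** The symmetric group S_3 acts on H3 \ox_H A because H is cocommutative, and
    replacing an argument or an operation of a composition by its flipped
    version changes the composition by a permutation. In degree 1 the
    deformation equation at (x, y, z), minus its transform under (12) at
    (y, x, z), plus its transform under a 3-cycle at (y, z, x), is the Leibniz
    rule. In degree 2 the alternating sum of the equation over S_3 is the Jacobi
    identity: the terms of the form T^(2)(x, y * z) and T^(2)(x * y, z) cancel
    under a transposition by commutativity of the product, and those of the form
    x * T^(2)(y, z) and T^(2)(x, y) * z cancel against each other, being
    exchanged by a 3-cycle. *)

(** * Additive maps, and their equality tested on pure tensors *)

Section AdditiveMaps.
Variables (U V : zmodType) (f : U -> V).
Hypothesis fD : {morph f : x y / x + y}.

Lemma morph_add0 : f 0 = 0.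
Proof. by apply: (addrI (f 0)); rewrite -fD !addr0. Qed.

Lemma morph_addN : {morph f : x / - x}.
Proof. by move=> x; apply: (addrI (f x)); rewrite -fD !subrr morph_add0. Qed.

Lemma morph_addB : {morph f : x y / x - y}.
Proof. by move=> x y; rewrite fD morph_addN. Qed.

End AdditiveMaps.

Lemma tensor_ext (k : fieldType) (U V : lmodType k) (Z : zmodType)
    (f g : (U \ox V)%type -> Z) :
    {morph f : x y / x + y} -> {morph g : x y / x + y} ->
  (forall u v, f (u \ox v) = g (u \ox v)) -> f =1 g.
Proof.
move=> fD gD fg; elim/tensor_ind=> [|x y IHx IHy|//].
  by rewrite (morph_add0 fD) (morph_add0 gD).
by rewrite fD gD IHx IHy.
Qed.

Lemma basechange_ext (R X : nzRingType) (phi : R -> X) (M : lmodType R)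
    (Z : zmodType) (f g : basechange phi M -> Z) :
    {morph f : x y / x + y} -> {morph g : x y / x + y} ->
  (forall x m, f (bcpure phi x m) = g (bcpure phi x m)) -> f =1 g.
Proof.
move=> fD gD fg; elim/basechange_ind=> [|x y IHx IHy|//].
  by rewrite (morph_add0 fD) (morph_add0 gD).
by rewrite fD gD IHx IHy.
Qed.

Lemma morph_comp (U V W : zmodType) (f : V -> W) (g : U -> V) :
    {morph f : x y / x + y} -> {morph g : x y / x + y} ->
  {morph (fun x => f (g x)) : x y / x + y}.
Proof. by move=> fD gD x y; rewrite gD fD. Qed.

(** * The action of S_3 on [H3] and its compatibility with the comultiplication *)

Section Permutations.
Variables (k : fieldType) (H : hopfAlgType k).
Implicit Types (f g h : H) (F G : H2 H) (X Y : H3 H).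

Lemma H3_ext (Z : zmodType) (p q : H3 H -> Z) :
    {morph p : x y / x + y} -> {morph q : x y / x + y} ->
  (forall f g h, p (f \ox g \ox h) = q (f \ox g \ox h)) -> p =1 q.
Proof.
move=> pD qD pq; apply: tensor_ext => // F h; move: F.
have hD : {morph (fun F => (F \ox h : H3 H)) : x y / x + y}.
  by move=> x y; exact: tpureDl.
by apply: tensor_ext => [||f g]; [exact: morph_comp|exact: morph_comp|exact: pq].
Qed.

Lemma flipD : {morph (fun F => tflip F : H2 H) : x y / x + y}.
Proof. exact: raddfD. Qed.

Lemma flipM : {morph (fun F => tflip F : H2 H) : x y / x * y}.
Proof. exact: rmorphM. Qed.

Lemma flipK F : tflip (tflip F) = F.
Proof.
move: F; apply: tensor_ext => // [|f g]; first exact: morph_comp flipD flipD.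
by rewrite !tflipE.
Qed.

Lemma swap12D : {morph @swap12 k H : x y / x + y}.
Proof. exact: raddfD. Qed.

Lemma swap12M : {morph @swap12 k H : x y / x * y}.
Proof. exact: rmorphM. Qed.

Lemma swap12E F h : swap12 (F \ox h) = tflip F \ox h.
Proof. exact: tmapE. Qed.

(** The cyclic permutation [f \ox g \ox h |-> h \ox f \ox g]. *)
Definition rot3 X : H3 H := tassoc (tflip X).

Lemma rot3D : {morph rot3 : x y / x + y}.
Proof.
have D1 : {morph @tflip k (H \ox H)%type H : x y / x + y} by exact: raddfD.
have D2 : {morph @tassoc k H H H : x y / x + y} by exact: raddfD.
by move=> x y; rewrite /rot3 D1 D2.
Qed.

Lemma rot3M : {morph rot3 : x y / x * y}.
Proof.
have D1 : {morph @tflip k (H \ox H)%type H : x y / x * y} by exact: rmorphM.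
have D2 : {morph @tassoc k H H H : x y / x * y} by exact: rmorphM.
by move=> x y; rewrite /rot3 D1 D2.
Qed.

Lemma rot3E F h : rot3 (F \ox h) = tassoc (h \ox F).
Proof. by rewrite /rot3 tflipE. Qed.

(** Built from (12) and the cycle, so that additivity and multiplicativity are inherited. As (12) is
    an involution, [rot3] is (12) after (23). *)
Definition swap23 X : H3 H := swap12 (rot3 X).

Lemma swap23D : {morph swap23 : x y / x + y}.
Proof. by move=> x y; rewrite /swap23 rot3D swap12D. Qed.

Lemma swap23M : {morph swap23 : x y / x * y}.
Proof. by move=> x y; rewrite /swap23 rot3M swap12M. Qed.

Lemma swap23E f g h : swap23 (f \ox g \ox h) = f \ox h \ox g.
Proof. by rewrite /swap23 rot3E tassocE swap12E tflipE. Qed.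

Lemma tassocD f : {morph (fun G => tassoc (f \ox G) : H3 H) : x y / x + y}.
Proof.
have D2 : {morph @tassoc k H H H : x y / x + y} by exact: raddfD.
by move=> x y; rewrite tpureDr D2.
Qed.

Lemma swap23_tassoc f G : swap23 (tassoc (f \ox G)) = tassoc (f \ox tflip G).
Proof.
move: G; apply: tensor_ext => [||g h].
- exact: morph_comp swap23D (@tassocD f).
- exact: morph_comp (@tassocD f) flipD.
- by rewrite tassocE swap23E tflipE tassocE.
Qed.

Lemma swap12K : involutive (@swap12 k H).
Proof.
apply: H3_ext => // [|f g h]; first exact: morph_comp swap12D swap12D.
by rewrite !swap12E flipK.
Qed.

Lemma swap23K : involutive swap23.
Proof.
apply: H3_ext => // [|f g h]; first exact: morph_comp swap23D swap23D.
by rewrite !swap23E.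
Qed.

(** Two words for the transposition (13); both arise when the Jacobi identity is expanded. *)
Lemma swap_braid X :
  swap12 (swap23 (swap12 X)) = swap23 (swap12 (swap23 X)).
Proof.
move: X; apply: H3_ext => [||f g h].
- exact: morph_comp swap12D (morph_comp swap23D swap12D).
- exact: morph_comp swap23D (morph_comp swap12D swap23D).
- by do !rewrite ?swap12E ?tflipE ?swap23E.
Qed.

(** Both sides send [f \ox g] to g followed by the coproduct of f. This is what turns left
    compositions into right ones. *)
Lemma rot3_comul_l F : rot3 (comul_l F) = comul_r (tflip F).
Proof.
move: F; apply: tensor_ext => [||f g].
- exact: morph_comp rot3D (@comul_lD _ _).
- exact: morph_comp (@comul_rD _ _) flipD.
- by rewrite comul_l_pure rot3E tflipE comul_r_pure.
Qed.

Lemma rot3_ins_r F : rot3 (ins_r F) = ins_l F.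
Proof. exact: rot3E. Qed.

Section Cocommutative.
Hypothesis Hcc : cocommutative H.

Lemma swap12_comul_l F : swap12 (comul_l F) = comul_l F.
Proof.
move: F; apply: tensor_ext => [||f g].
- exact: morph_comp swap12D (@comul_lD _ _).
- exact: comul_lD.
- by rewrite comul_l_pure swap12E Hcc.
Qed.

Lemma swap23_comul_r F : swap23 (comul_r F) = comul_r F.
Proof.
move: F; apply: tensor_ext => [||f g].
- exact: morph_comp swap23D (@comul_rD _ _).
- exact: comul_rD.
- by rewrite comul_r_pure swap23_tassoc Hcc.
Qed.

(** By coassociativity the last two factors of [comul3 h] also form coproducts, so (23) fixes it;
    hence (23) descends to the tensor product over [H]. *)
Lemma swap23_comul3 X h : swap23 (X * comul3 h) = swap23 X * comul3 h.
Proof.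
rewrite swap23M; congr (_ * _).
by rewrite /comul3 comulA; exact: swap23_comul_r.
Qed.

End Cocommutative.
End Permutations.

(** * The induced action on [H3mod] *)

Section ModulePermutations.
Variables (k : fieldType) (H : hopfAlgType k).
Hypothesis Hcc : cocommutative H.

Section OneModule.
Variable N : lmodType H.
Implicit Types (u v : H2mod N) (w : H3mod N).

Definition swap23_id : H3mod N -> H3mod N :=
  bcmap (@comul3 k H) (@comul3 k H) (@swap23 k H).

Lemma swap23_idE X (x : N) :
  swap23_id (bcpure (@comul3 k H) X x) = bcpure (@comul3 k H) (swap23 X) x.
Proof. exact: bcmapE (@swap23D _ _) (swap23_comul3 Hcc) _ _. Qed.

Lemma swap23_idD : {morph swap23_id : x y / x + y}.
Proof. exact: bcmapD (@swap23D _ _) (swap23_comul3 Hcc). Qed.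

Lemma swap23_idZ X w : swap23_id (X *: w) = swap23 X *: swap23_id w.
Proof. exact: bcmapZ (@swap23D _ _) (swap23_comul3 Hcc) (@swap23M _ _) _ _. Qed.

Lemma swap12_idD : {morph @swap12_id k H N : x y / x + y}.
Proof. exact: bcmapD (@swap12D _ _) (swap12_comul3 Hcc). Qed.

Lemma swap12_idZ X w : swap12_id (X *: w) = swap12 X *: swap12_id w.
Proof. exact: bcmapZ (@swap12D _ _) (swap12_comul3 Hcc) (@swap12M _ _) _ _. Qed.

Lemma sigma_idD : {morph @sigma_id k H N : x y / x + y}.
Proof. exact: bcmapD (@flipD _ _) (tflip_comul Hcc). Qed.

Lemma sigma_idZ (F : H2 H) u : sigma_id (F *: u) = (tflip F : H2 H) *: sigma_id u.
Proof. exact: bcmapZ (@flipD _ _) (tflip_comul Hcc) (@flipM _ _) _ _. Qed.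

Lemma sigma_idK : involutive (@sigma_id k H N).
Proof.
apply: basechange_ext => // [|F x]; first exact: morph_comp sigma_idD sigma_idD.
by rewrite !(sigma_idE Hcc) flipK.
Qed.

Lemma swap12_idK : involutive (@swap12_id k H N).
Proof.
apply: basechange_ext => // [|X x]; first exact: morph_comp swap12_idD swap12_idD.
by rewrite !(swap12_idE Hcc) swap12K.
Qed.

Lemma swap23_idK : involutive swap23_id.
Proof.
apply: basechange_ext => // [|X x]; first exact: morph_comp swap23_idD swap23_idD.
by rewrite !swap23_idE swap23K.
Qed.

Lemma swap_id_braid w :
  swap12_id (swap23_id (swap12_id w)) = swap23_id (swap12_id (swap23_id w)).
Proof.
move: w; apply: basechange_ext => [||X x].
- exact: morph_comp swap12_idD (morph_comp swap23_idD swap12_idD).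
- exact: morph_comp swap23_idD (morph_comp swap12_idD swap23_idD).
- by do !rewrite ?(swap12_idE Hcc) ?swap23_idE; rewrite swap_braid.
Qed.

Definition coml_id : H2mod N -> H3mod N :=
  bcmap (@comul k H : H -> H2 H) (@comul3 k H) (@comul_l k H).
Definition comr_id : H2mod N -> H3mod N :=
  bcmap (@comul k H : H -> H2 H) (@comul3 k H) (@comul_r k H).

Lemma coml_idE F (x : N) :
  coml_id (bcpure (@comul k H : H -> H2 H) F x) = bcpure (@comul3 k H) (comul_l F) x.
Proof. exact: bcmapE (@comul_lD _ _) (@comul_l_comul _ _) _ _. Qed.

Lemma coml_idD : {morph coml_id : x y / x + y}.
Proof. exact: bcmapD (@comul_lD _ _) (@comul_l_comul _ _). Qed.

Lemma comr_idE F (x : N) :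
  comr_id (bcpure (@comul k H : H -> H2 H) F x) = bcpure (@comul3 k H) (comul_r F) x.
Proof. exact: bcmapE (@comul_rD _ _) (@comul_r_comul _ _) _ _. Qed.

Lemma comr_idD : {morph comr_id : x y / x + y}.
Proof. exact: bcmapD (@comul_rD _ _) (@comul_r_comul _ _). Qed.

Lemma swap12_coml_id u : swap12_id (coml_id u) = coml_id u.
Proof.
move: u; apply: basechange_ext => [||F x].
- exact: morph_comp swap12_idD coml_idD.
- exact: coml_idD.
- by rewrite coml_idE (swap12_idE Hcc) swap12_comul_l.
Qed.

Lemma swap23_comr_id u : swap23_id (comr_id u) = comr_id u.
Proof.
move: u; apply: basechange_ext => [||F x].
- exact: morph_comp swap23_idD comr_idD.
- exact: comr_idD.
- by rewrite comr_idE swap23_idE swap23_comul_r.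
Qed.

Lemma rot_coml_id u :
  swap12_id (swap23_id (coml_id u)) = comr_id (sigma_id u).
Proof.
move: u; apply: basechange_ext => [||F x].
- exact: morph_comp swap12_idD (morph_comp swap23_idD coml_idD).
- exact: morph_comp comr_idD sigma_idD.
- rewrite coml_idE swap23_idE (swap12_idE Hcc) (sigma_idE Hcc) comr_idE.
  by rewrite /swap23 swap12K rot3_comul_l.
Qed.

End OneModule.

(** * Compositions: additivity, flips of the inner value, differences of operations *)

Section Compositions.
Variables L M N : lmodType H.
Implicit Types mu : L -> M -> H2mod N.

Lemma comp_l_additive mu : H2linear mu ->
  forall z, {morph comp_l mu ^~ z : u v / u + v}.
Proof.
move=> muL z; case: (muL) => muDl muDr muZ; apply: bcliftD.
split=> [x F1 F2|F x1 x2|F r x].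
- by rewrite ins_rD scalerDl.
- by rewrite muDl (bcmapD (@comul_lD _ _) (@comul_l_comul _ _)) scalerDr.
(* With z written as [1 *: z], linearity extracts [r \ox 1], which [comul_l] sends to
   [ins_r (comul r)]. *)
- rewrite -[z in RHS]scale1r muZ.
  rewrite (bcmapZ (@comul_lD _ _) (@comul_l_comul _ _) (@comul_lM _ _)).
  by rewrite scalerA comul_l_pure ins_rM.
Qed.

Lemma comp_r_additive mu : H2linear mu ->
  forall x, {morph comp_r mu x : u v / u + v}.
Proof.
move=> muL z; case: (muL) => muDl muDr muZ; apply: bcliftD.
split=> [x F1 F2|F x1 x2|F r x].
- by rewrite ins_lD scalerDl.
- by rewrite muDr (bcmapD (@comul_rD _ _) (@comul_r_comul _ _)) scalerDr.
- rewrite -[z in RHS]scale1r muZ.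
  rewrite (bcmapZ (@comul_rD _ _) (@comul_r_comul _ _) (@comul_rM _ _)).
  by rewrite scalerA comul_r_pure ins_lM.
Qed.

(** The flip only affects the inserted factor [ins_r F]: the remaining part has a coproduct in its
    first two places and is fixed by (12). *)
Lemma comp_l_sigma mu u z : H2linear mu ->
  comp_l mu (sigma_id u) z = swap12_id (comp_l mu u z).
Proof.
move=> muL; move: u; apply: basechange_ext => [||F x].
- exact: morph_comp (comp_l_additive muL z) (@sigma_idD _).
- exact: morph_comp (@swap12_idD _) (comp_l_additive muL z).
- rewrite (sigma_idE Hcc) !(comp_lE muL) -/(coml_id _) swap12_idZ.
  by rewrite swap12_coml_id /ins_r swap12E.
Qed.

Lemma comp_r_sigma mu x v : H2linear mu ->
  comp_r mu x (sigma_id v) = swap23_id (comp_r mu x v).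
Proof.
move=> muL; move: v; apply: basechange_ext => [||F y].
- exact: morph_comp (comp_r_additive muL x) (@sigma_idD _).
- exact: morph_comp (@swap23_idD _) (comp_r_additive muL x).
- rewrite (sigma_idE Hcc) !(comp_rE muL) -/(comr_id _) swap23_idZ.
  by rewrite swap23_comr_id /ins_l swap23_tassoc.
Qed.

Lemma H2linearB (lam mu nu : L -> M -> H2mod N) :
    H2linear mu -> H2linear nu ->
  (forall x y, lam x y = mu x y - nu x y) -> H2linear lam.
Proof.
case=> muDl muDr muZ [nuDl nuDr nuZ] E; split=> [b x y|a x y|f g a b].
- by rewrite !E muDl nuDl opprD addrACA.
- by rewrite !E muDr nuDr opprD addrACA.
- by rewrite !E muZ nuZ scalerBr.
Qed.

Lemma comp_lB (lam mu nu : L -> M -> H2mod N) u z :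
    H2linear mu -> H2linear nu ->
    (forall x y, lam x y = mu x y - nu x y) ->
  comp_l lam u z = comp_l mu u z - comp_l nu u z.
Proof.
move=> muL nuL E; have lamL := H2linearB muL nuL E; move: u.
apply: basechange_ext => [||F x].
- exact: comp_l_additive.
- by move=> u v; rewrite !comp_l_additive // opprD addrACA.
- rewrite (comp_lE muL) (comp_lE nuL) (comp_lE lamL) E -!/(coml_id _).
  by rewrite (morph_addB (@coml_idD N)) scalerBr.
Qed.

Lemma comp_rB (lam mu nu : L -> M -> H2mod N) x v :
    H2linear mu -> H2linear nu ->
    (forall x y, lam x y = mu x y - nu x y) ->
  comp_r lam x v = comp_r mu x v - comp_r nu x v.
Proof.
move=> muL nuL E; have lamL := H2linearB muL nuL E; move: v.
apply: basechange_ext => [||F y].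
- exact: comp_r_additive.
- by move=> u v; rewrite !comp_r_additive // opprD addrACA.
- rewrite (comp_rE muL) (comp_rE nuL) (comp_rE lamL) E -!/(comr_id _).
  by rewrite (morph_addB (@comr_idD N)) scalerBr.
Qed.

End Compositions.

(** * Compositions with the opposite operation *)

Section Opposite.
Variables L M N : lmodType H.
Variables (mu : L -> M -> H2mod N) (nu : M -> L -> H2mod N).
Hypothesis nuE : forall y x, nu y x = sigma_id (mu x y).
Hypothesis muL : H2linear mu.

Lemma H2linear_opposite : H2linear nu.
Proof.
case: muL => muDl muDr muZ; split=> [b x y|a x y|f g a b].
- by rewrite !nuE muDr sigma_idD.
- by rewrite !nuE muDl sigma_idD.
- by rewrite !nuE muZ sigma_idZ tflipE.
Qed.

Lemma comp_l_opposite u x :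
  comp_l nu u x = swap23_id (swap12_id (comp_r mu x u)).
Proof.
have nuL := H2linear_opposite.
(* The inverse form is easier: (12) after (23) is the cycle [rot3], whose effect on [comul_l] and
   [ins_r] is known. *)
suff <- : swap12_id (swap23_id (comp_l nu u x)) = comp_r mu x u.
  by rewrite swap12_idK swap23_idK.
move: u; apply: basechange_ext => [||F y].
- exact: morph_comp (@swap12_idD _) (morph_comp (@swap23_idD _) (comp_l_additive nuL x)).
- exact: comp_r_additive.
- rewrite (comp_lE nuL) (comp_rE muL) -/(coml_id _) -/(comr_id _).
  rewrite swap23_idZ swap12_idZ rot_coml_id nuE sigma_idK.
  by rewrite /swap23 swap12K rot3_ins_r.
Qed.

End Opposite.

Lemma comp_r_opposite (L M N : lmodType H) (mu : L -> M -> H2mod N)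
    (nu : M -> L -> H2mod N) y v :
    (forall y x, nu y x = sigma_id (mu x y)) -> H2linear mu ->
  comp_r nu y v = swap12_id (swap23_id (comp_l mu v y)).
Proof.
move=> nuE muL; have nuL := H2linear_opposite nuE muL.
have muE x z : mu x z = sigma_id (nu z x) by rewrite nuE sigma_idK.
by rewrite (comp_l_opposite muE nuL) swap23_idK swap12_idK.
Qed.

End ModulePermutations.

(** * Combinations of the deformation equations in an abelian group *)

(** Moves each summand [- x] and its partner [x] to the end of the sum, where
    they cancel; every atom must occur once with each sign. *)
Ltac zmod_cancel :=
  apply/eqP; rewrite -subr_eq0; apply/eqP;
  rewrite -[LHS]add0r !(opprD, opprK, addrA);
  repeat match goal with |- context [- ?x] =>
    rewrite ?(addrAC _ x) ?(addrAC _ (- x)) addrK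
  end.

(** First equation minus second plus third. The letters a, b, c, d stand for T(x, y * z), T(x * y,
    z), x * T(y, z), T(x, y) * z up to permutation; a repeated letter is a term shared by two
    equations. *)
Lemma leibniz_combination (V : zmodType) (a1 a2 b1 b3 c1 c2 c3 d1 d2 : V) :
    c1 + a1 = d1 + b1 -> c2 + a2 = d2 + b1 -> c3 + a2 = c1 + b3 ->
  a1 - b3 = d1 - d2 + (c2 - c3).
Proof.
move=> /(canRL (addKr _)) -> /(canRL (addrK _)) ->.
move=> /esym /(canRL (addKr _)) ->; zmod_cancel; done.
Qed.

(** The equations enter with signs +, -, -, +, +, -. Here R and L are the double compositions of
    [T 1], a and b the terms with the product inside, c those with the product outside, on either
    side of the equation. *)
Lemma jacobi_combination (V : zmodType)
    (a1 a2 a3 b1 b2 b3 c1 c2 c3 c4 c5 c6 : V)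
    (R1 R2 R3 R4 R5 R6 L1 L2 L3 L4 L5 L6 : V) :
    c1 + R1 + a1 = c5 + L1 + b1 -> c2 + R2 + a2 = c6 + L2 + b1 ->
    c3 + R3 + a1 = c2 + L3 + b2 -> c4 + R4 + a2 = c1 + L4 + b3 ->
    c5 + R5 + a3 = c4 + L5 + b2 -> c6 + R6 + a3 = c3 + L6 + b3 ->
  L1 - L2 - (R5 - R6) = R1 - R3 - (L4 - L6) - (R2 - R4 - (L3 - L5)).
Proof.
have E (a b c d R L : V) : c + R + a = d + L + b -> R = d + L + b - a - c.
  by move=> <-; rewrite addrK addrC addKr.
by do 6!move=> /E ->; zmod_cancel.
Qed.

(** * The commutator bracket of a deformation *)

Section Deformation.
Variables (k : fieldType) (H : hopfAlgType k).
Hypothesis Hcc : cocommutative H.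
Variables (Omega : Type) (op : SemiGroup.com_law Omega) (A : lmodType H).
Implicit Types S T : omega_product Omega A.
Implicit Types (a b c : Omega) (x y z : A).

Local Notation s12 := (@swap12_id k H A).
Local Notation s23 := (@swap23_id k H A).

(** Permuted arguments carry permuted indices, whose products must agree for terms to cancel. *)
Let opC a b : op a b = op b a.
Proof. exact: SemiGroup.opC. Qed.

Section Identities.
Variables S T : omega_product Omega A.
Hypothesis SC : omega_commutative S.
Hypothesis TL : forall a b, H2linear (T a b).
Hypothesis SL : forall a b, H2linear (S a b).

Lemma comp_r_comm a b c x y z :
  comp_r (T a (op b c)) x (S b c y z) =
  s23 (comp_r (T a (op c b)) x (S c b z y)).
Proof. by rewrite SC (comp_r_sigma Hcc) // (opC b). Qed.

Lemma comp_l_comm a b c x y z :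
  comp_l (T (op a b) c) (S a b x y) z =
  s12 (comp_l (T (op b a) c) (S b a y x) z).
Proof. by rewrite SC (comp_l_sigma Hcc) // (opC a). Qed.

(** A commutative product is its own opposite, so with the product outside the two kinds of
    composition differ by a 3-cycle. *)
Lemma comp_l_of_comp_r a b c x y z :
  comp_l (S (op a b) c) (T a b x y) z =
  s23 (s12 (comp_r (S c (op a b)) z (T a b x y))).
Proof. by rewrite (comp_l_opposite Hcc (SC _ _)). Qed.

End Identities.

Section Commutator.
Variable T : omega_product Omega A.
Hypothesis TL : forall a b, H2linear (T a b).

Definition commutator : omega_product Omega A :=
  fun a b x y => T a b x y - sigma_id (T b a y x).

Let Top a b x y := sigma_id (T b a y x).

Let TopL a b : H2linear (Top a b).
Proof. exact: (H2linear_opposite Hcc (fun _ _ => erefl)). Qed.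

Lemma commutator_linear a b : H2linear (commutator a b).
Proof. exact: H2linearB (TL a b) (TopL a b) (fun _ _ => erefl). Qed.

Lemma commutator_skew a b x y : commutator a b x y = - sigma_id (commutator b a y x).
Proof.
by rewrite /commutator (morph_addB (@sigma_idD _ _ Hcc _)) (sigma_idK Hcc) opprB.
Qed.

(** The subtracted operation is the opposite of [T], so its left composition is a permuted right
    composition of [T]. *)
Lemma comp_l_commutator a b u z :
  comp_l (commutator a b) u z =
  comp_l (T a b) u z - s23 (s12 (comp_r (T b a) z u)).
Proof.
rewrite (comp_lB _ _ (TL a b) (TopL a b) (fun _ _ => erefl)); congr (_ - _).
exact: (comp_l_opposite Hcc (fun _ _ => erefl)).
Qed.

Lemma comp_r_commutator a b x v :
  comp_r (commutator a b) x v =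
  comp_r (T a b) x v - s12 (s23 (comp_l (T b a) v x)).
Proof.
rewrite (comp_rB _ _ (TL a b) (TopL a b) (fun _ _ => erefl)); congr (_ - _).
exact: (comp_r_opposite Hcc _ _ (fun _ _ => erefl)).
Qed.

Lemma comp_l_in_commutator (mu : A -> A -> H2mod A) a b x y z : H2linear mu ->
  comp_l mu (commutator a b x y) z =
  comp_l mu (T a b x y) z - s12 (comp_l mu (T b a y x) z).
Proof.
move=> muL; rewrite (morph_addB (comp_l_additive muL z)).
by rewrite (comp_l_sigma Hcc).
Qed.

Lemma comp_r_in_commutator (mu : A -> A -> H2mod A) a b x y z : H2linear mu ->
  comp_r mu x (commutator a b y z) =
  comp_r mu x (T a b y z) - s23 (comp_r mu x (T b a z y)).
Proof.
move=> muL; rewrite (morph_addB (comp_r_additive muL x)).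
by rewrite (comp_r_sigma Hcc).
Qed.

End Commutator.

Variables (star : omega_product Omega A) (T : nat -> omega_product Omega A).
Hypothesis starC : omega_commutative star.
Hypothesis starL : forall a b, H2linear (star a b).
Hypothesis T_deformation : formal_deformation op star T.

Let TL i a b : H2linear (T i a b).
Proof. exact: deformation_linear T_deformation i a b. Qed.

Let T0 : T 0%N = star.
Proof. by do 4!apply: funext => ?; exact: deformation0 T_deformation _ _ _ _. Qed.

Lemma deformation_order1 a b c x y z :
  comp_r (star a (op b c)) x (T 1%N b c y z) +
  comp_r (T 1%N a (op b c)) x (star b c y z) =
  comp_l (star (op a b) c) (T 1%N a b x y) z +
  comp_l (T 1%N (op a b) c) (star a b x y) z.
Proof.
have := deformationA T_deformation 1 a b c x y z.
by rewrite !big_ord_recr !big_ord0 /= !add0r T0.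
Qed.

Lemma deformation_order2 a b c x y z :
  comp_r (star a (op b c)) x (T 2%N b c y z) +
  comp_r (T 1%N a (op b c)) x (T 1%N b c y z) +
  comp_r (T 2%N a (op b c)) x (star b c y z) =
  comp_l (star (op a b) c) (T 2%N a b x y) z +
  comp_l (T 1%N (op a b) c) (T 1%N a b x y) z +
  comp_l (T 2%N (op a b) c) (star a b x y) z.
Proof.
have := deformationA T_deformation 2 a b c x y z.
by rewrite !big_ord_recr !big_ord0 /= !add0r T0.
Qed.

Let s12D := @swap12_idD k H Hcc A.
Let s23D := @swap23_idD k H Hcc A.
Let s12K := @swap12_idK k H Hcc A.
Let s23K := @swap23_idK k H Hcc A.
Let s12B := morph_addB s12D.
Let s23B := morph_addB s23D.

Lemma commutator_leibniz a b c x y z :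
  comp_r (commutator (T 1%N) a (op b c)) x (star b c y z) =
  comp_l (star (op a b) c) (commutator (T 1%N) a b x y) z +
  s12 (comp_r (star b (op a c)) y (commutator (T 1%N) a c x z)).
Proof.
rewrite comp_r_commutator // comp_l_in_commutator // comp_r_in_commutator //.
rewrite s12B; apply: leibniz_combination.
- exact: deformation_order1.
- have := congr1 s12 (deformation_order1 b a c y x z).
  rewrite !s12D -(comp_l_comm starC (TL 1)) (opC b a) => E; exact E.
(* The term T(y, z * x) is matched with T(y, x * z) of the second equation, and T(y, z) * x with x *
   T(y, z) of the first. *)
- have := congr1 (fun w => s12 (s23 w)) (deformation_order1 b c a y z x).
  rewrite !s23D !s12D -(comp_r_comm starC (TL 1)) (opC c a) => ->.
  by rewrite (comp_l_of_comp_r _ starC starL) s23K s12K.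
Qed.

Lemma commutator_jacobi a b c x y z :
  comp_l (commutator (T 1%N) (op a b) c) (commutator (T 1%N) a b x y) z =
  comp_r (commutator (T 1%N) a (op b c)) x (commutator (T 1%N) b c y z) -
  s12 (comp_r (commutator (T 1%N) b (op a c)) y (commutator (T 1%N) a c x z)).
Proof.
have braid := @swap_id_braid k H Hcc A.
have dc := comp_l_of_comp_r (T 2%N) starC starL.
have ac := comp_r_comm starC (TL 2).
have bc := comp_l_comm starC (TL 2).
rewrite comp_l_commutator // !comp_r_commutator // !comp_l_in_commutator //.
(* The transposition (13) is normalized to (23)(12)(23) to match the six equations below. *)
rewrite !comp_r_in_commutator // !(s12B, s23B) !s12K braid.
apply: jacobi_combination.
- have := deformation_order2 a b c x y z; rewrite dc => E; exact E.
- have := congr1 s12 (deformation_order2 b a c y x z).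
  rewrite !s12D -bc dc braid (opC b a) => E; exact E.
- have := congr1 s23 (deformation_order2 a c b x z y).
  rewrite !s23D -ac dc s23K (opC c b) => E; exact E.
- have := congr1 (fun w => s12 (s23 w)) (deformation_order2 b c a y z x).
  rewrite !s23D !s12D -ac dc s23K s12K (opC c a) => E; exact E.
- have := congr1 (fun w => s23 (s12 w)) (deformation_order2 c a b z x y).
  (* [dc] produces the square of the cycle (23)(12); the braid relation read backwards exposes a
     square of (12) and leaves the inverse cycle (12)(23). *)
  rewrite !s12D !s23D -bc dc -braid s12K (opC c a) => E; exact E.
- have := congr1 (fun w => s23 (s12 (s23 w))) (deformation_order2 c b a z y x).
  rewrite !s23D !s12D !s23D -ac dc s23K s12K.
  (* Only this term leaves the normal form of (13): [bc] needs (12) next to the composition. *)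
  rewrite -[s23 (s12 (s23 (comp_l _ (star c b z y) x)))]braid -bc.
  rewrite (opC b a) (opC c b) => E; exact E.
Qed.

End Deformation.

Theorem theorem6p7 (k : closedFieldType) (pchar0 : [pchar k] =i pred0)
  (H : hopfAlgType k) (cocommH : cocommutative H)
  (Omega : Type) (op : SemiGroup.com_law Omega)
  (A : lmodType H) (star : omega_product Omega A)
  (star_assoc : omega_associative op star)
  (star_comm : omega_commutative star)
  (T : nat -> omega_product Omega A)
  (T_deformation : formal_deformation op star T) :
  omega_poisson op
    (fun a b x y => T 1%N a b x y - sigma_id (T 1%N b a y x))
    star.
Proof.
have starL := omega_assoc_linear star_assoc.
have TL := deformation_linear T_deformation 1.
split=> //; last exact: (commutator_leibniz cocommH star_comm starL T_deformation).
split.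
- exact: (commutator_linear cocommH TL).
- exact: (commutator_skew cocommH (T 1%N)).
- exact: (commutator_jacobi cocommH star_comm starL T_deformation).
Qed.
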